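(* For every integer $r\ge3$ with $r\neq5$ there exists a permutation $\sigma$ of $F^r$ with $\sigma(\mathbf 0)=\mathbf 0$ such that the extended perfect code $S_\sigma$ of length $2^{r+1}$ is neighbor transitive and non-Mollard.
   Context: $F=\mathrm{GF}(2)$, $\mathbf 0$ the all-zero vector. Index coordinates of $F^{2^r}$ by $F^r$; $e_a$ is the unit vector at $a$; $\mathcal H=\{x\in F^{2^r}:\sum_{a:x_a=1}a=\mathbf 0,\ \mathrm{wt}(x)\text{ even}\}$; $x|y$ is concatenation and $C\times D=\{x|y:x\in C,y\in D\}$; $S_\sigma=\bigcup_{a\in F^r}(\mathcal H+e_a+e_{\mathbf 0})\times(\mathcal H+e_{\sigma(a)}+e_{\sigma(\mathbf 0)})$. Codes $C,D\subseteq F^n$ are isomorphic if $x+\pi(C)=D$ for some $x$ and coordinate permutation $\pi$ ($\pi(y)_i=y_{\pi^{-1}(i)}$). $\mathrm{Aut}(C)$ is the stabilizer of $C$ in the group of maps $y\mapsto x+\pi(y)$; $C$ is neighbor transitive if $\mathrm{Aut}(C)$ acts transitively on $C$ and on the set of words at distance exactly $1$ from $C$. For binary extended perfect codes $C$ (length $t$), $D$ (length $m$) and $\phi:C\to F^m$, the Mollard code is $\{z\in F^{tm}:p_1(z)\in C,\ p_2(z)\in\phi(p_1(z))+D\}$, with coordinates $(i,s)$ and $p_1(z)=(\sum_s z_{1s},\ldots,\sum_s z_{ts})$, $p_2(z)=(\sum_i z_{i1},\ldots,\sum_i z_{im})$. A code is non-Mollard if it is not isomorphic to any Mollard code. *)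

(* Defs.v *)
From HB Require Import structures.
From mathcomp Require Import all_boot all_order all_fingroup all_algebra.
Set Implicit Arguments. Unset Strict Implicit. Unset Printing Implicit Defensive.
Import GRing.Theory.
Local Open Scope ring_scope.

Notation Fr r := 'rV['F_2]_r.

Notation word I := {ffun I -> 'F_2}.

Definition wt (I : finType) (x : word I) : nat := #|[set i | x i != 0]|.
Definition dist (I : finType) (x y : word I) : nat := wt (x - y).

Definition e (I : finType) (a : I) : word I := [ffun i => if i == a then 1 else 0].

Definition coset (I : finType) (C : {set word I}) (v : word I) : {set word I} :=
  [set (c : word I) + v | c in C].

Definition Hcode (r : nat) : {set word (Fr r)} :=
  [set x : word (Fr r) | (\sum_(a : Fr r | x a == 1) a == 0) && ~~ odd (wt x)].

Definition concat (I : finType) (x y : word I) : word (I + I) :=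
  [ffun i => match i with inl a => x a | inr b => y b end].

Definition cprod (I : finType) (C D : {set word I}) : {set word (I + I)} :=
  [set concat x y | x in C, y in D].

Definition S_sigma (r : nat) (s : {perm Fr r}) : {set word (Fr r + Fr r)} :=
  \bigcup_(a : Fr r)
     cprod (coset (Hcode r) (e a + e 0)) (coset (Hcode r) (e (s a) + e (s 0))).

Definition amap (I : finType) (x : word I) (p : {perm I}) (y : word I) : word I :=
  x + [ffun i => y ((p^-1)%g i)].

Definition in_Aut (I : finType) (C : {set word I}) (x : word I) (p : {perm I}) :=
  [set amap x p (y : word I) | y in C] = C.

Definition neighbors (I : finType) (C : {set word I}) : {set word I} :=
  [set y | (y \notin C) && [exists c in C, dist y c == 1%N]].

Definition Aut_transitive_on (I : finType) (C A : {set word I}) :=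
  forall u v, u \in A -> v \in A ->
    exists (x : word I) (p : {perm I}), in_Aut C x p /\ amap x p u = v.

Definition neighbor_transitive (I : finType) (C : {set word I}) :=
  Aut_transitive_on C C /\ Aut_transitive_on C (neighbors C).

Definition ext_perfect (I : finType) (C : {set word I}) :=
  (2 * #|I| * #|C| = 2 ^ #|I|)%N /\
  (forall c d, c \in C -> d \in C -> c != d -> (4 <= dist c d)%N).

(* isomorphism: D = x + pi(C) for a coordinate bijection pi : I -> J
   (g is the inverse bijection J -> I, so pi(y)_j = y_(g j)) *)
Definition isomorphic (I J : finType) (C : {set word I}) (D : {set word J}) :=
  exists (x : word J) (g : J -> I), bijective g /\
    D = [set x + [ffun j => (y : word I) (g j)] | y in C].

Definition p1 (t m : nat) (z : word ('I_t * 'I_m)) : word 'I_t :=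
  [ffun i => \sum_(s : 'I_m) z (i, s)].
Definition p2 (t m : nat) (z : word ('I_t * 'I_m)) : word 'I_m :=
  [ffun s => \sum_(i : 'I_t) z (i, s)].

Definition Mollard (t m : nat) (C : {set word 'I_t}) (D : {set word 'I_m})
    (phi : word 'I_t -> word 'I_m) : {set word ('I_t * 'I_m)} :=
  [set z | (p1 z \in C) && (p2 z \in coset D (phi (p1 z)))].

Definition non_Mollard (I : finType) (S : {set word I}) :=
  forall (t m : nat) (C : {set word 'I_t}) (D : {set word 'I_m})
         (phi : word 'I_t -> word 'I_m),
    (2 <= t)%N -> (2 <= m)%N -> ext_perfect C -> ext_perfect D ->
    ~ isomorphic S (Mollard C D phi).

(* Main.v *)
(* Since sigma(0) = 0, S_sigma consists of the words x|y with x, y of even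
   weight and syn y = sigma(syn x), where syn x is the sum of the support.
   - If sigma is an involution, exchanging the halves preserves S_sigma, and
     translations of F^r acting on one half preserve it as well: the
     stabilizer of the zero codeword is transitive on coordinates.
   - If sigma is an automorphism of a binary operation m on F^r such that every
     m a is affine, injective and sends 0 to a, then the pairs
     (m a, m (sigma a)), followed by a translation, move the zero codeword to
     every codeword.
   - If no derivative of sigma in a nonzero direction is constant, then a word
     w with w + S_sigma = S_sigma has zero syndrome on both halves; such a word
     of weight 4 lies in one half.  A Mollard code is invariant under the
     addition of all rectangles of its t x m coordinate grid, and these would
     force all coordinates into one half.
   These conditions on sigma are stable under direct sums, and they are realized
   for r = 3 and r = 4; every r >= 3 except 5 is of the form 3a + 4b. *)
Require Import Defs.
From mathcomp Require Import all_boot all_order all_fingroup all_algebra.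
From mathcomp Require Import ring.

Set Implicit Arguments. Unset Strict Implicit. Unset Printing Implicit Defensive.
Import GRing.Theory.
Local Open Scope ring_scope.

(** * Structured involutions of [F^r]: dimensions 3 and 4, then direct sums *)

(** Over [GF(2)] a map is affine when it preserves sums of three points, whence [si_affine]. In
    [si_nonlinear] a constant derivative in direction [a] must equal its value [s a] at [x = 0],
    because [s 0 = 0]. *)
Record structured_involution (r : nat) (s : Fr r -> Fr r)
    (m : Fr r -> Fr r -> Fr r) : Prop := StructuredInvolution {
  si_invol : involutive s;
  si_0 : s 0 = 0;
  si_nonlinear : forall a, (forall x, s (x + a) = s x + s a) -> a = 0;
  si_mul : forall a b, s (m a b) = m (s a) (s b);
  si_mulr0 : forall a, m a 0 = a;
  si_inj : forall a, injective (m a);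
  si_affine : forall a x y z, m a (x + y + z) = m a x + m a y + m a z }.

Lemma F2P (x : 'F_2) : {x = 0} + {x = 1}.
Proof. by case: x => [[|[|n]] // Hn]; [left | right]; apply: val_inj. Qed.

Lemma addFF (x : 'F_2) : x + x = 0.
Proof. by case: (F2P x) => ->; apply/eqP. Qed.

Lemma addrr_Fr r (x : Fr r) : x + x = 0.
Proof. by apply/rowP=> i; rewrite !mxE addFF. Qed.

Lemma addrK_Fr r (y x : Fr r) : x + y + y = x.
Proof. by rewrite -addrA addrr_Fr addr0. Qed.

Lemma add_eq0_Fr r (x y : Fr r) : x + y = 0 -> x = y.
Proof. by move=> h; rewrite -[x](addrK_Fr y) h add0r. Qed.

(* In dimensions 3 and 4 the operation m is a group law on F^r acting on itself by
   affine maps, found together with its automorphism s by computer search. *)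
Lemma structured_involution3 :
  exists s m, @structured_involution 3 s m.
Proof.
pose i0 : 'I_3 := inord 0; pose i1 : 'I_3 := inord 1; pose i2 : 'I_3 := inord 2.
pose row3 (x y z : 'F_2) : Fr 3 := \row_i nth 0 [:: x; y; z] i.
have r0 x y z : row3 x y z 0 i0 = x by rewrite !mxE /= inordK.
have r1 x y z : row3 x y z 0 i1 = y by rewrite !mxE /= inordK.
have r2 x y z : row3 x y z 0 i2 = z by rewrite !mxE /= inordK.
have eta (v : Fr 3) : v = row3 (v 0 i0) (v 0 i1) (v 0 i2).
  apply/rowP; case=> [[|[|[|n]]] // Hn]; rewrite !mxE /=; congr (v _ _);
  by apply: val_inj; rewrite /= inordK.
have row3D x y z x' y' z' :
    row3 x y z + row3 x' y' z' = row3 (x + x') (y + y') (z + z').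
  by apply/rowP; case=> [[|[|[|n]]] // Hn]; rewrite !mxE.
have row30 : 0 = row3 0 0 0 by rewrite [LHS]eta !mxE.
have row3_inj x y z x' y' z' : row3 x y z = row3 x' y' z' ->
    [/\ x = x', y = y' & z = z'].
  move=> h; have h' i := congr1 (fun v : Fr 3 => v 0 i) h.
  by move: (h' i0) (h' i1) (h' i2); rewrite !(r0, r1, r2).
pose s (v : Fr 3) := let a := v 0 i0 in let b := v 0 i1 in let c := v 0 i2 in
  row3 (b + a * c + b * c) (a + b * c) c.
pose m (v w : Fr 3) :=
  let a := v 0 i0 in let b := v 0 i1 in let c := v 0 i2 in
  let a' := w 0 i0 in let b' := w 0 i1 in let c' := w 0 i2 in
  row3 (a + a' + c * b' + b * c') (b + b') (c + c').
have sE a b c : s (row3 a b c) = row3 (b + a * c + b * c) (a + b * c) c.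
  by rewrite /s !(r0, r1, r2).
have mE a b c a' b' c' : m (row3 a b c) (row3 a' b' c') =
    row3 (a + a' + c * b' + b * c') (b + b') (c + c').
  by rewrite /m !(r0, r1, r2).
exists s, m; split.
- move=> v; rewrite (eta v); move: (v 0 i0) (v 0 i1) (v 0 i2) => a b c.
  rewrite !sE; case: (F2P a) (F2P b) (F2P c) => [] -> [] -> [] ->;
  by congr row3; apply/eqP.
- by rewrite row30 sE; congr row3; apply/eqP.
- move=> v; rewrite (eta v) row30.
  move: (v 0 i0) (v 0 i1) (v 0 i2) => a b c h.
  (* The defect of additivity of [s] is [(c, c, 0)] against [row3 0 1 0] and [(a + b, b, 0)] against
     [row3 0 0 1], so these two tests force [a = b = c = 0]. *)
  have := h (row3 0 1 0); have := h (row3 0 0 1).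
  rewrite !(row3D, sE) => /row3_inj[+ + _] /row3_inj[+ + _].
  by case: (F2P a) (F2P b) (F2P c) => [] -> [] -> [] -> //.
- move=> v w; rewrite (eta v) (eta w).
  move: (v 0 i0) (v 0 i1) (v 0 i2) (w 0 i0) (w 0 i1) (w 0 i2) => a b c a' b' c'.
  rewrite !(mE, sE).
  case: (F2P a) (F2P b) (F2P c) => [] -> [] -> [] ->;
  by case: (F2P a') (F2P b') (F2P c') => [] -> [] -> [] ->; congr row3; apply/eqP.
- move=> v; rewrite (eta v) row30 mE.
  by congr row3; rewrite ?mulr0 !addr0.
- move=> v x y; rewrite (eta v) (eta x) (eta y) !mE => /row3_inj[].
  by move=> + /addrI e1 /addrI e2; rewrite e1 e2 => h; rewrite (addrI _ (addIr _ (addIr _ h))).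
- move=> v x y z; rewrite (eta v) (eta x) (eta y) (eta z) !(row3D, mE).
  move: (v 0 i0) (v 0 i1) (v 0 i2) => a b c.
  (* The constant term of [m v] occurs once on the left and three times on the right; tripling it
     first reduces the claim to a ring identity. *)
  have add3 (u : 'F_2) : u = u + u + u by rewrite addFF add0r.
  by congr row3; [rewrite [in LHS](add3 a)|rewrite [in LHS](add3 b)|
                  rewrite [in LHS](add3 c)]; ring.
Qed.

Lemma structured_involution4 :
  exists s m, @structured_involution 4 s m.
Proof.
pose i0 : 'I_4 := inord 0; pose i1 : 'I_4 := inord 1.
pose i2 : 'I_4 := inord 2; pose i3 : 'I_4 := inord 3.
pose row4 (x y z t : 'F_2) : Fr 4 := \row_i nth 0 [:: x; y; z; t] i.
have r0 x y z t : row4 x y z t 0 i0 = x by rewrite !mxE /= inordK.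
have r1 x y z t : row4 x y z t 0 i1 = y by rewrite !mxE /= inordK.
have r2 x y z t : row4 x y z t 0 i2 = z by rewrite !mxE /= inordK.
have r3 x y z t : row4 x y z t 0 i3 = t by rewrite !mxE /= inordK.
have eta (v : Fr 4) : v = row4 (v 0 i0) (v 0 i1) (v 0 i2) (v 0 i3).
  apply/rowP; case=> [[|[|[|[|n]]]] // Hn]; rewrite !mxE /=; congr (v _ _);
  by apply: val_inj; rewrite /= inordK.
have row4D x y z t x' y' z' t' :
    row4 x y z t + row4 x' y' z' t' =
      row4 (x + x') (y + y') (z + z') (t + t').
  by apply/rowP; case=> [[|[|[|[|n]]]] // Hn]; rewrite !mxE.
have row40 : 0 = row4 0 0 0 0 by rewrite [LHS]eta !mxE.
have row4_inj x y z t x' y' z' t' : row4 x y z t = row4 x' y' z' t' ->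
    [/\ x = x', y = y', z = z' & t = t'].
  move=> h; have h' i := congr1 (fun v : Fr 4 => v 0 i) h.
  by move: (h' i0) (h' i1) (h' i2) (h' i3); rewrite !(r0, r1, r2, r3).
pose s (v : Fr 4) := let a := v 0 i0 in let b := v 0 i1 in let c := v 0 i2 in let d := v 0 i3 in
  row4 (b + a * c + b * c * d) (a + b * d) d c.
pose m (v w : Fr 4) :=
  let a := v 0 i0 in let b := v 0 i1 in let c := v 0 i2 in let d := v 0 i3 in
  let a' := w 0 i0 in let b' := w 0 i1 in let c' := w 0 i2 in let d' := w 0 i3 in
  row4 (a + a' + d * b' + c * c' + b * d') (b + b' + d * d') (c + c') (d + d').
have sE a b c d : s (row4 a b c d) = row4 (b + a * c + b * c * d) (a + b * d) d c.
  by rewrite /s !(r0, r1, r2, r3).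
have mE a b c d a' b' c' d' : m (row4 a b c d) (row4 a' b' c' d') =
    row4 (a + a' + d * b' + c * c' + b * d') (b + b' + d * d') (c + c') (d + d').
  by rewrite /m !(r0, r1, r2, r3).
exists s, m; split.
- move=> v; rewrite (eta v); move: (v 0 i0) (v 0 i1) (v 0 i2) (v 0 i3) => a b c d.
  rewrite !sE; case: (F2P a) (F2P b) (F2P c) (F2P d) => [] -> [] -> [] -> [] ->;
  by congr row4; apply/eqP.
- by rewrite row40 sE; congr row4; apply/eqP.
- move=> v; rewrite (eta v) row40.
  move: (v 0 i0) (v 0 i1) (v 0 i2) (v 0 i3) => a b c d h.
  (* The selected coordinates give, in this order of test vectors, [c = 0], [d = 0], [a + b * d = 0]
     and [b = 0]. *)
  have := h (row4 1 0 0 0); have := h (row4 0 1 0 0).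
  have := h (row4 0 0 1 0); have := h (row4 0 0 0 1).
  rewrite !(row4D, sE) => /row4_inj[_ + _ _] /row4_inj[+ _ _ _] /row4_inj[_ + _ _] /row4_inj[+ _ _ _].
  by case: (F2P a) (F2P b) (F2P c) (F2P d) => [] -> [] -> [] -> [] -> //.
- move=> v w; rewrite (eta v) (eta w).
  move: (v 0 i0) (v 0 i1) (v 0 i2) (v 0 i3) (w 0 i0) (w 0 i1) (w 0 i2) (w 0 i3) => a b c d a' b' c' d'.
  rewrite !(mE, sE).
  case: (F2P a) (F2P b) (F2P c) (F2P d) => [] -> [] -> [] -> [] ->;
  by case: (F2P a') (F2P b') (F2P c') (F2P d') => [] -> [] -> [] -> [] ->; congr row4; apply/eqP.
- move=> v; rewrite (eta v) row40 mE.
  by congr row4; rewrite ?mulr0 !addr0.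
- move=> v x y; rewrite (eta v) (eta x) (eta y) !mE => /row4_inj[].
  move=> + + /addrI e2 /addrI e3; rewrite e2 e3 => + h.
  rewrite (addrI _ (addIr _ h)) => {}h.
  by rewrite (addrI _ (addIr _ (addIr _ (addIr _ h)))).
- move=> v x y z; rewrite (eta v) (eta x) (eta y) (eta z) !(row4D, mE).
  move: (v 0 i0) (v 0 i1) (v 0 i2) (v 0 i3) => a b c d.
  have add3 (u : 'F_2) : u = u + u + u by rewrite addFF add0r.
  by congr row4; [rewrite [in LHS](add3 a)|rewrite [in LHS](add3 b)|
                  rewrite [in LHS](add3 c)|
                  rewrite [in LHS](add3 d)]; ring.
Qed.

(** Everything acts blockwise. For nonlinearity, testing on vectors supported in one block shows
    that the corresponding block of [a] vanishes. *)
Lemma structured_involutionD r1 r2 s1 m1 s2 m2 :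
  @structured_involution r1 s1 m1 -> @structured_involution r2 s2 m2 ->
  exists s m, @structured_involution (r1 + r2) s m.
Proof.
move=> H1 H2.
pose s (v : Fr (r1 + r2)) := row_mx (s1 (lsubmx v)) (s2 (rsubmx v)).
pose m (v w : Fr (r1 + r2)) :=
  row_mx (m1 (lsubmx v) (lsubmx w)) (m2 (rsubmx v) (rsubmx w)).
have ls v : lsubmx (s v) = s1 (lsubmx v) by rewrite row_mxKl.
have rs v : rsubmx (s v) = s2 (rsubmx v) by rewrite row_mxKr.
have row_mx_ext (v w : Fr (r1 + r2)) :
    lsubmx v = lsubmx w -> rsubmx v = rsubmx w -> v = w.
  by move=> hl hr; rewrite -[v]hsubmxK hl hr hsubmxK.
exists s, m; split.
- by move=> v; rewrite /s row_mxKl row_mxKr (si_invol H1) (si_invol H2) hsubmxK.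
- by rewrite /s !linear0 (si_0 H1) (si_0 H2) row_mx0.
- move=> a h; apply: row_mx_ext; rewrite linear0.
    apply: (si_nonlinear H1) => x.
    by have /(congr1 lsubmx) := h (row_mx x 0); rewrite linearD /= !ls linearD /= row_mxKl.
  apply: (si_nonlinear H2) => x.
  by have /(congr1 rsubmx) := h (row_mx 0 x); rewrite linearD /= !rs linearD /= row_mxKr.
- by move=> a b; rewrite /s /m !(row_mxKl, row_mxKr) (si_mul H1) (si_mul H2).
- by move=> a; rewrite /m !linear0 (si_mulr0 H1) (si_mulr0 H2) hsubmxK.
- move=> a x y /eq_row_mx[/(si_inj H1) hl /(si_inj H2) hr]; exact: row_mx_ext.
- by move=> a x y z; rewrite /m !add_row_mx !linearD /= (si_affine H1) (si_affine H2).
Qed.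

Lemma structured_involution_exists r : (3 <= r)%N -> r != 5%N ->
  exists s m, @structured_involution r s m.
Proof.
have H3 := structured_involution3; have H4 := structured_involution4.
have HD a b : (exists s m, @structured_involution a s m) ->
    (exists s m, @structured_involution b s m) ->
    exists s m, @structured_involution (a + b) s m.
  by move=> [s1 [m1 h1]] [s2 [m2 h2]]; apply: structured_involutionD h1 h2.
elim/ltn_ind: r => r IH hr hr5.
have [->//|r3] := eqVneq r 3; have [->//|r4] := eqVneq r 4.
(* The induction removes a summand 3; from 8 this would lead to the excluded 5, so 8 is split as 4 +
   4. *)
have [->|r8] := eqVneq r 8; first exact: (HD 4%N 4%N).
have rge : (6 <= r)%N by case: r hr hr5 r3 r4 {IH r8} => [|[|[|[|[|[|r]]]]]].
rewrite -(subnKC hr); apply: HD => //; apply: IH.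
- by rewrite ltn_subrL /= (leq_trans _ hr).
- by rewrite leq_subRL.
- by apply: contra r8 => /eqP h; rewrite -(subnKC hr) h.
Qed.

(** * Parity and small weights of binary words *)

Section Words.
Variable I : finType.
Implicit Types (x y : word I) (i : I).

Definition par x : 'F_2 := \sum_i x i.

Lemma parD x y : par (x + y) = par x + par y.
Proof. by rewrite /par -big_split; apply: eq_bigr => i _; rewrite ffunE. Qed.

Lemma par0 : par 0 = 0.
Proof. by rewrite /par big1 // => i _; rewrite ffunE. Qed.

Lemma par_e i : par (e i) = 1.
Proof.
by rewrite /par (bigD1 i) //= ffunE eqxx big1 ?addr0 // => j /negbTE h; rewrite ffunE h.
Qed.

Lemma addww x : x + x = 0.
Proof. by apply/ffunP=> i; rewrite !ffunE addFF. Qed.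

Lemma addwK y x : x + y + y = x.
Proof. by rewrite -addrA addww addr0. Qed.

Lemma subw x y : x - y = x + y.
Proof.
apply/ffunP=> i; rewrite !ffunE; congr (_ + _).
by case: (F2P (y i)) => ->; apply/eqP.
Qed.

Lemma par_wt x : par x = (wt x)%:R.
Proof.
rewrite /par /wt -sum1_card natr_sum [LHS](bigID (fun i => x i != 0)) /=.
rewrite [X in _ + X]big1 ?addr0 => [|i /negbNE/eqP //].
by apply: eq_big => [i|i]; rewrite ?inE //; case: (F2P (x i)) => ->.
Qed.

Lemma odd_wt x : odd (wt x) = (par x != 0).
Proof.
rewrite par_wt -[wt x in RHS]odd_double_half natrD -addnn natrD addFF addr0.
by case: odd.
Qed.

Lemma wt1 x : wt x = 1%N -> exists i, x = e i.
Proof.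
move=> /eqP/cards1P[i h]; exists i; apply/ffunP=> j; rewrite ffunE.
have := in_set1 j i; rewrite -h inE; case: (F2P (x j)) => -> //=; by case: eqP.
Qed.

Lemma wt2 x : wt x = 2%N -> exists i j, i != j /\ x = e i + e j.
Proof.
move=> /eqP/cards2P[i [j [hij h]]]; exists i, j; split=> //.
apply/ffunP=> k; rewrite !ffunE.
have := in_set2 k i j; rewrite -h inE.
have [->|_] := eqVneq k i; first by rewrite (negbTE hij) addr0; case: (F2P (x i)) => ->.
by rewrite add0r; case: (F2P (x k)) => -> //=; case: eqP.
Qed.

Lemma wt0 x : wt x = 0%N -> x = 0.
Proof.
move=> /eqP; rewrite cards_eq0 => /eqP h; apply/ffunP=> i; rewrite ffunE.
by have := in_set0 i; rewrite -h inE => /negbFE/eqP.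
Qed.

End Words.

(** * Orbits of words under the automorphism group of a code *)

Section Reach.
Variables (I : finType) (C : {set word I}).

Lemma amap_inj x (p : {perm I}) : injective (amap x p).
Proof.
move=> y z /addrI/ffunP h; apply/ffunP=> i.
by have := h (p i); rewrite !ffunE permK.
Qed.

(** An injective map of a finite set into itself is onto, so stability in one direction suffices. *)
Lemma in_AutI x (p : {perm I}) : (forall y, y \in C -> amap x p y \in C) -> in_Aut C x p.
Proof.
move=> h; apply/eqP; rewrite eqEcard card_imset ?leqnn ?andbT; last exact: amap_inj.
by apply/subsetP=> _ /imsetP[y hy ->]; apply: h.
Qed.

Lemma in_Aut_mem x (p : {perm I}) y : in_Aut C x p -> (amap x p y \in C) = (y \in C).
Proof. by move=> h; rewrite -{1}h mem_imset //; apply: amap_inj. Qed.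

Definition reach u v := exists (x : word I) (p : {perm I}), in_Aut C x p /\ amap x p u = v.

Lemma reach_trans u v w : reach u v -> reach v w -> reach u w.
Proof.
move=> [x [p [hp <-]]] [y [q [hq <-]]].
have E z : amap y q (amap x p z) = amap (y + [ffun i => x ((q^-1)%g i)]) (p * q)%g z.
  by apply/ffunP=> i; rewrite !ffunE addrA invMg permM.
exists (y + [ffun i => x ((q^-1)%g i)]), (p * q)%g; split; last by rewrite E.
by apply: in_AutI => z hz; rewrite -E !in_Aut_mem.
Qed.

Lemma reach_sym u v : reach u v -> reach v u.
Proof.
move=> [x [p [hp <-]]].
have E z : amap (- [ffun i => x (p i)]) p^-1%g (amap x p z) = z.
  by apply/ffunP=> i; rewrite !ffunE invgK permK addrA addNr add0r.
exists (- [ffun i => x (p i)]), p^-1%g; split=> //.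
by apply: in_AutI => z; rewrite -{1}hp => /imsetP[y hy ->]; rewrite E.
Qed.

End Reach.

Lemma reindex_perm_e (I : finType) (p : {perm I}) i :
  [ffun j => e i ((p^-1)%g j)] = e (p i).
Proof.
by apply/ffunP=> j; rewrite !ffunE (can2_eq (permKV p) (permK p)).
Qed.

(** * Syndromes and the membership criterion for [S_sigma] *)

Section Syndrome.
Variable r : nat.
Implicit Types (x y : word (Fr r)) (z : word (Fr r + Fr r)).

Definition syn x : Fr r := \sum_a x a *: a.

Lemma synD x y : syn (x + y) = syn x + syn y.
Proof. by rewrite /syn -big_split; apply: eq_bigr => i _; rewrite ffunE scalerDl. Qed.

Lemma syn0 : syn 0 = 0.
Proof. by rewrite /syn big1 // => i _; rewrite ffunE scale0r. Qed.

Lemma syn_e a : syn (e a) = a.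
Proof.
rewrite /syn (bigD1 a) //= ffunE eqxx scale1r big1 ?addr0 // => j /negbTE h.
by rewrite ffunE h scale0r.
Qed.

Lemma mem_Hcode x : (x \in Hcode r) = (par x == 0) && (syn x == 0).
Proof.
rewrite inE odd_wt negbK andbC; congr (_ && (_ == _)).
rewrite /syn [RHS](bigID (fun a => x a == 1)) /= [X in _ + X]big1 ?addr0.
  by apply: eq_bigr => a /eqP ->; rewrite scale1r.
by move=> a; case: (F2P (x a)) => -> // _; rewrite scale0r.
Qed.

Definition lft z : word (Fr r) := [ffun a => z (inl a)].
Definition rgt z : word (Fr r) := [ffun a => z (inr a)].

Lemma lftD z w : lft (z + w) = lft z + lft w.
Proof. by apply/ffunP=> a; rewrite !ffunE. Qed.

Lemma rgtD z w : rgt (z + w) = rgt z + rgt w.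
Proof. by apply/ffunP=> a; rewrite !ffunE. Qed.

Lemma lft0 : lft 0 = 0. Proof. by apply/ffunP=> a; rewrite !ffunE. Qed.
Lemma rgt0 : rgt 0 = 0. Proof. by apply/ffunP=> a; rewrite !ffunE. Qed.

Lemma lft_concat x y : lft (concat x y) = x.
Proof. by apply/ffunP=> a; rewrite !ffunE. Qed.

Lemma rgt_concat x y : rgt (concat x y) = y.
Proof. by apply/ffunP=> a; rewrite !ffunE. Qed.

Lemma concat_eta z : z = concat (lft z) (rgt z).
Proof. by apply/ffunP=> [[a|a]]; rewrite !ffunE. Qed.

Lemma lft_e i : lft (e i) = if i is inl a then e a else 0.
Proof. by apply/ffunP=> b; case: i => a; rewrite !ffunE. Qed.

Lemma rgt_e i : rgt (e i) = if i is inr a then e a else 0.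
Proof. by apply/ffunP=> b; case: i => a; rewrite !ffunE. Qed.

(** The coset of [Hcode r] by [e a + e 0] consists of the even words with syndrome [a], so the index
    [a] of the union can only be [syn (lft z)]. *)
Lemma mem_S_sigma (s : {perm Fr r}) z : s 0 = 0 ->
  (z \in S_sigma s) =
  [&& par (lft z) == 0, par (rgt z) == 0 & syn (rgt z) == s (syn (lft z))].
Proof.
move=> s0; apply/bigcupP/and3P.
  move=> [a _ /imset2P[_ _ /imsetP[h + ->] /imsetP[k + ->] ->]].
  rewrite !mem_Hcode => /andP[/eqP h1 /eqP h2] /andP[/eqP k1 /eqP k2].
  rewrite lft_concat rgt_concat !(parD, synD, par_e, syn_e) h1 h2 k1 k2.
  by rewrite s0 !add0r !addr0 addFF.
move=> [/eqP h1 /eqP h2 /eqP h3]; exists (syn (lft z)) => //.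
rewrite [z]concat_eta lft_concat; apply: imset2_f; apply/imsetP.
  exists (lft z + (e (syn (lft z)) + e 0)); last by rewrite addwK.
  by rewrite mem_Hcode !(parD, synD, par_e, syn_e) h1 addFF !addr0 addrr_Fr !eqxx.
exists (rgt z + (e (s (syn (lft z))) + e (s 0))); last by rewrite addwK.
by rewrite mem_Hcode !(parD, synD, par_e, syn_e) h2 addFF h3 s0 !addr0 addrr_Fr !eqxx.
Qed.

End Syndrome.

(** * Coordinate permutations of the two halves and their effect on syndromes *)

Section SumPerm.
Variable T : finType.

Definition sum_fun (A B : T -> T) (i : T + T) : T + T :=
  match i with inl a => inl (A a) | inr b => inr (B b) end.

Lemma sum_fun_inj A B : injective A -> injective B -> injective (sum_fun A B).
Proof. by move=> hA hB [a|a] [b|b] //= [] => [/hA|/hB] ->. Qed.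

Definition sum_perm A B (hA : injective A) (hB : injective B) : {perm T + T} :=
  perm (sum_fun_inj hA hB).

Definition swap_fun (i : T + T) : T + T :=
  match i with inl a => inr a | inr a => inl a end.

Lemma swap_fun_inj : injective swap_fun.
Proof. by case=> a [] b //= [->]. Qed.

Definition swap_perm : {perm T + T} := perm swap_fun_inj.

End SumPerm.

Section PermWords.
Variable r : nat.
Implicit Types (y : word (Fr r + Fr r)).

Lemma par_perm (I : finType) (p : {perm I}) (x : word I) :
  par [ffun i => x ((p^-1)%g i)] = par x.
Proof.
rewrite /par (reindex_inj (@perm_inj _ p)) /=.
by apply: eq_bigr => i _; rewrite ffunE permK.
Qed.

Lemma syn_perm (p : {perm Fr r}) (x : word (Fr r)) :
  syn [ffun i => x ((p^-1)%g i)] = \sum_a x a *: p a.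
Proof.
rewrite /syn (reindex_inj (@perm_inj _ p)) /=.
by apply: eq_bigr => i _; rewrite ffunE permK.
Qed.

(** [L] is the additive part of [A] and commutes with the sum; the constants [A 0] contributed by
    the support of [x] cancel because the weight is even. *)
Lemma syn_affine (A : Fr r -> Fr r) (x : word (Fr r)) :
  (forall u v w, A (u + v + w) = A u + A v + A w) -> par x = 0 ->
  \sum_a x a *: A a = A (syn x) + A 0.
Proof.
move=> hA hx; pose L v := A v + A 0.
have LD u v : L (u + v) = L u + L v.
  by rewrite /L -[u + v]addr0 hA [RHS]addrACA addrA.
have L0 : L 0 = 0 by rewrite /L addrr_Fr.
have -> : A (syn x) + A 0 = \sum_a x a *: L a.
  rewrite -/(L _) /syn (big_morph L LD L0); apply: eq_bigr => a _.
  by case: (F2P (x a)) => ->; rewrite ?scale0r ?scale1r.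
rewrite /L; under [RHS]eq_bigr do rewrite scalerDr.
by rewrite big_split /= -scaler_suml -/(par x) hx scale0r addr0.
Qed.

Lemma lft_sum_perm A B (hA : injective A) (hB : injective B) y :
  lft [ffun i => y (((sum_perm hA hB)^-1)%g i)] =
  [ffun a => lft y (((perm hA)^-1)%g a)].
Proof.
apply/ffunP=> a; rewrite !ffunE; congr (y _).
by apply: (@perm_inj _ (sum_perm hA hB)); rewrite permKV permE /= -[in RHS](permE hA) permKV.
Qed.

Lemma rgt_sum_perm A B (hA : injective A) (hB : injective B) y :
  rgt [ffun i => y (((sum_perm hA hB)^-1)%g i)] =
  [ffun a => rgt y (((perm hB)^-1)%g a)].
Proof.
apply/ffunP=> a; rewrite !ffunE; congr (y _).
by apply: (@perm_inj _ (sum_perm hA hB)); rewrite permKV permE /= -[in RHS](permE hB) permKV.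
Qed.

Lemma lft_swap_perm y : lft [ffun i => y (((swap_perm (Fr r))^-1)%g i)] = rgt y.
Proof.
apply/ffunP=> a; rewrite !ffunE; congr (y _).
by apply: (@perm_inj _ (swap_perm (Fr r))); rewrite permKV permE.
Qed.

Lemma rgt_swap_perm y : rgt [ffun i => y (((swap_perm (Fr r))^-1)%g i)] = lft y.
Proof.
apply/ffunP=> a; rewrite !ffunE; congr (y _).
by apply: (@perm_inj _ (swap_perm (Fr r))); rewrite permKV permE.
Qed.

End PermWords.

(** Adding [e i] exchanges odd and even words. *)
Lemma card_odd_words (I : finType) (i : I) :
  (2 * #|[set x : word I | par x != 0%R]| = 2 ^ #|I|)%N.
Proof.
have <- : #|word I| = (2 ^ #|I|)%N by rewrite card_ffun card_ord.
rewrite -(cardsC [set x : word I | par x != 0]) mul2n -addnn; congr addn.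
rewrite -(card_imset _ (addrI (e i))); apply: eq_card => x.
rewrite !inE negbK; apply/imsetP/eqP => [[y + ->]|hx].
  by rewrite inE parD par_e; case: (F2P (par y)) => ->; rewrite ?eqxx // addFF.
exists (x + e i); last by rewrite addrCA addww addr0.
by rewrite inE parD par_e hx add0r.
Qed.

Lemma par_sum_word r (z : word (Fr r + Fr r)) : par z = par (lft z) + par (rgt z).
Proof.
rewrite /par big_sumType /=.
by congr (_ + _); apply: eq_bigr => a _; rewrite ffunE.
Qed.

(** * Invariance of Mollard codes under rectangles *)

Section MollardRectangles.
Variables t m : nat.
Implicit Types z w : word ('I_t * 'I_m).

Lemma p1D z w : p1 (z + w) = p1 z + p1 w.
Proof.
by apply/ffunP=> i; rewrite !ffunE -big_split; apply: eq_bigr => s _; rewrite ffunE.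
Qed.

Lemma p2D z w : p2 (z + w) = p2 z + p2 w.
Proof.
by apply/ffunP=> s; rewrite !ffunE -big_split; apply: eq_bigr => i _; rewrite ffunE.
Qed.

Lemma p1_e (i : 'I_t) (s : 'I_m) : p1 (e (i, s)) = e i.
Proof.
apply/ffunP=> j; rewrite !ffunE (bigD1 s) //= ffunE xpair_eqE eqxx andbT.
by rewrite big1 ?addr0 // => k /negbTE h; rewrite ffunE xpair_eqE h andbF.
Qed.

Lemma p2_e (i : 'I_t) (s : 'I_m) : p2 (e (i, s)) = e s.
Proof.
apply/ffunP=> k; rewrite !ffunE (bigD1 i) //= ffunE xpair_eqE eqxx /=.
by rewrite big1 ?addr0 // => j /negbTE h; rewrite ffunE xpair_eqE h.
Qed.

(** The four corners contribute [e i + e j] twice to [p1], and [e u] and [e v] twice each to [p2],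
    so neither projection changes. *)
Lemma Mollard_rectangle (i j : 'I_t) (u v : 'I_m) C D phi z :
  z \in Mollard C D phi ->
  z + (e (i, u) + e (j, u) + (e (i, v) + e (j, v))) \in Mollard C D phi.
Proof. by rewrite !inE !(p1D, p2D) !(p1_e, p2_e) !addww !addr0. Qed.

End MollardRectangles.

(** * [S_sigma] is extended perfect *)

Section Code.
Variables (r : nat) (s : {perm Fr r}).
Hypothesis s0 : s 0 = 0.
Local Notation S := (S_sigma s).

Lemma S_sigma_par z : z \in S -> par z = 0.
Proof. by rewrite mem_S_sigma // par_sum_word => /and3P[/eqP-> /eqP-> _]; rewrite addr0. Qed.

(** Distances are even, so only 2 must be excluded. Two changes in different halves break the
    parities; two changes in one half alter the syndrome of that half only, which injectivity of [s]
    forbids. *)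
Lemma S_sigma_dist c d : c \in S -> d \in S -> c != d -> (4 <= dist c d)%N.
Proof.
move=> hc hd hcd; rewrite /dist subw.
have : ~~ odd (wt (c + d)).
  by rewrite odd_wt negbK parD !S_sigma_par // addr0.
have : wt (c + d) != 0%N.
  by apply: contraNneq hcd => /wt0 h; rewrite -[c](addwK d) h add0r.
suff : wt (c + d) != 2%N by case: wt => [|[|[|[|n]]]].
apply/eqP => /wt2[i [j [hij h]]].
have {h hd}: c + (e i + e j) \in S by rewrite -h addrA addww add0r.
move: hc; rewrite !mem_S_sigma // => /and3P[/eqP h1 /eqP h2 /eqP h3].
rewrite !(lftD, rgtD, parD, synD, lft_e, rgt_e) h1 h2 h3 !add0r.
case: i j hij => a [] b hij; rewrite !(par0, par_e, syn0, syn_e, addr0, add0r) //.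
  move=> /and3P[_ _ /eqP/perm_inj]; rewrite -[LHS]addr0 => /addrI/esym/add_eq0_Fr h.
  by rewrite h eqxx in hij.
move=> /and3P[_ _ /eqP]; rewrite -[RHS]addr0 => /addrI/add_eq0_Fr h.
by rewrite h eqxx in hij.
Qed.

Lemma S_sigma_cover z : par z != 0 -> exists2 c, c \in S & exists i, z = c + e i.
Proof.
rewrite par_sum_word => hz.
suff [i hi] : exists i, z + e i \in S.
  by exists (z + e i) => //; exists i; rewrite addwK.
case: (F2P (par (lft z))) hz => hl; case: (F2P (par (rgt z))) => hr;
  rewrite hl hr ?addr0 ?add0r ?addFF ?eqxx // => _.
  (* Exactly one half is odd; the bit to flip lies there, at the position that corrects the syndrome
     of that half. *)
  exists (inr (syn (rgt z) + s (syn (lft z)))).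
  rewrite mem_S_sigma // !(lftD, rgtD, parD, synD, lft_e, rgt_e) hl hr.
  rewrite !(par0, par_e, syn0, syn_e) addFF !addr0 !eqxx /=.
  by rewrite addrA addrr_Fr add0r.
exists (inl (syn (lft z) + (s^-1)%g (syn (rgt z)))).
rewrite mem_S_sigma // !(lftD, rgtD, parD, synD, lft_e, rgt_e) hl hr.
rewrite !(par0, par_e, syn0, syn_e) addFF !addr0 !eqxx /=.
by rewrite addrA addrr_Fr add0r permKV.
Qed.

(** The map sending [(c, i)] to [c + e i] is a bijection from pairs of a codeword and a coordinate
    to odd words: onto by [S_sigma_cover], injective since a collision of distinct codewords would
    put them at distance at most 2. *)
Lemma S_sigma_ext_perfect : ext_perfect S.
Proof.
split; last exact: S_sigma_dist.
rewrite -(card_odd_words (inl 0)) -mulnA; congr muln.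
rewrite mulnC -cardsT -cardsX -(@card_in_imset _ _ 
  (fun u : word (Fr r + Fr r) * (Fr r + Fr r) => u.1 + e u.2)).
  apply: eq_card => z; rewrite inE; apply/imsetP/idP.
    by move=> [[c i]]; rewrite inE /= => /andP[/S_sigma_par hc _] ->; rewrite parD par_e hc.
  by move=> /S_sigma_cover[c hc [i ->]]; exists (c, i); rewrite // !inE hc.
move=> [c i] [d j]; rewrite !inE /= !andbT => hc hd h.
have hcd : c + d = e i + e j.
  rewrite -[c](addwK (e i)) h addrC !addrA addww add0r; exact: addrC.
have [cd|cd] := eqVneq c d.
  move: h; rewrite cd => /addrI/ffunP/(_ i); rewrite !ffunE eqxx.
  by case: eqP => [-> //|_ /eqP].
have := S_sigma_dist hc hd cd; rewrite /dist subw hcd leqNgt => /negP[].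
have /subset_leq_card : [set k | (e i + e j) k != 0] \subset [set i; j].
  by apply/subsetP=> k; rewrite !inE !ffunE; case: (k =P i); case: (k =P j).
by move=> /leq_ltn_trans; apply; rewrite cards2; case: eqP.
Qed.


Lemma S_sigma_concat a : concat (e a + e 0) (e (s a) + e 0) \in S.
Proof.
rewrite mem_S_sigma // lft_concat rgt_concat !(parD, synD, par_e, syn_e) addFF.
by rewrite !addr0 !eqxx.
Qed.

Lemma S_sigma0 : 0 \in S.
Proof. by rewrite mem_S_sigma // lft0 rgt0 par0 syn0 s0 !eqxx. Qed.

(** * Neighbor transitivity *)

Variable m : Fr r -> Fr r -> Fr r.
Hypothesis sm : structured_involution s m.

Lemma reach_codeword c : c \in S -> reach S 0 c.
Proof.
move=> hc; pose a := syn (lft c).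
exists c, (sum_perm (@si_inj _ _ _ sm a) (@si_inj _ _ _ sm (s a))); split; last first.
  by apply/ffunP=> i; rewrite !ffunE addr0.
apply: in_AutI => y; move: hc; rewrite !mem_S_sigma // => /and3P[/eqP c1 /eqP c2 /eqP c3].
move=> /and3P[/eqP y1 /eqP y2 /eqP y3].
rewrite /amap !(lftD, rgtD) lft_sum_perm rgt_sum_perm !(parD, synD, par_perm).
rewrite !syn_perm c1 c2 y1 y2 addr0 eqxx /=.
under eq_bigr do rewrite permE; under [X in s (_ + X)]eq_bigr do rewrite permE.
(* The permutation turns the left syndrome into [m a (syn (lft y)) + a], and adding [c] removes the
   [a]; likewise on the right with [s a]. The two syndromes are then related by [si_mul]. *)
rewrite !syn_affine //; try exact: si_affine sm _.
have H (u v : Fr r) : u + (v + u) = v by rewrite addrC addrK_Fr.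
by rewrite !(si_mulr0 sm) y3 c3 -/a !H (si_mul sm).
Qed.

(** Translating the coordinates of the left half by [a + b] fixes the syndrome of every even
    word. *)
Lemma reach_e_shift (a b : Fr r) : reach S (e (inl a)) (e (inl b)).
Proof.
pose p := sum_perm (addrI (a + b)) (@inj_id (Fr r)).
exists 0, p; split; last by rewrite /amap add0r reindex_perm_e permE /= addrAC addrr_Fr add0r.
apply: in_AutI => y; rewrite !mem_S_sigma // => /and3P[/eqP y1 /eqP y2 /eqP y3].
rewrite /amap add0r lft_sum_perm rgt_sum_perm !par_perm !syn_perm y1 y2 eqxx /=.
under eq_bigr do rewrite permE; under [X in s X]eq_bigr do rewrite permE scalerDr.
rewrite big_split /= -scaler_suml -/(par _) y1 scale0r add0r.
by rewrite -!/(syn _) y3.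
Qed.

Lemma reach_e_swap (a : Fr r) : reach S (e (inl a)) (e (inr a)).
Proof.
exists 0, (swap_perm (Fr r)).
split; last by rewrite /amap add0r reindex_perm_e permE.
apply: in_AutI => y; rewrite !mem_S_sigma // => /and3P[/eqP y1 /eqP y2 /eqP y3].
rewrite /amap add0r lft_swap_perm rgt_swap_perm y1 y2 y3 eqxx /=.
by rewrite (si_invol sm).
Qed.

Lemma reach_e i j : reach S (e i) (e j).
Proof.
have H k : reach S (e (inl 0)) (e k).
  by case: k => a; [|apply: reach_trans (reach_e_swap a)]; apply: reach_e_shift.
by apply: reach_trans (H j); apply: reach_sym; apply: H.
Qed.

Lemma reach_neighbor u : u \in neighbors S -> reach S (e (inl 0)) u.
Proof.
rewrite inE => /andP[_ /exists_inP[c hc]]; rewrite /dist => /eqP/wt1[i].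
rewrite subw => /(congr1 (+%R^~ c)); rewrite addwK => ->.
have [x [p [hp]]] := reach_codeword hc => xp.
(* The automorphism sending [0] to [c] sends [e k] to [c + e (p k)], so [k] is the preimage of [i]
   under [p]. *)
apply: reach_trans (reach_e _ ((p^-1)%g i)) _; exists x, p; split=> //.
rewrite /amap reindex_perm_e permKV -xp addrC; congr (_ + _).
by apply/ffunP=> k; rewrite !ffunE addr0.
Qed.

Lemma S_sigma_neighbor_transitive : neighbor_transitive S.
Proof.
split=> u v hu hv; first by apply: reach_trans (reach_codeword hv); apply/reach_sym/reach_codeword.
by apply: reach_trans (reach_neighbor hv); apply/reach_sym/reach_neighbor.
Qed.

(** * Translations preserving [S_sigma], and the exclusion of Mollard codes *)

(** Shifting [0] shows that the right syndrome of [w] is [s] of the left one; shifting a codeword of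
    left syndrome [x], for every [x], then makes the derivative of [s] in the direction
    [syn (lft w)] constant. *)
Lemma S_sigma_kernel w : (forall z, z \in S -> z + w \in S) ->
  par (lft w) = 0 /\ syn (lft w) = 0.
Proof.
move=> hw; have := hw _ S_sigma0; rewrite add0r mem_S_sigma // => /and3P[/eqP w1 /eqP w2 /eqP w3].
split=> //; apply: (si_nonlinear sm) => x; have := hw _ (S_sigma_concat x).
rewrite mem_S_sigma // !(lftD, rgtD) lft_concat rgt_concat => /and3P[_ _ /eqP].
by rewrite !(synD, syn_e) !addr0 w3.
Qed.

Definition isl (T : Type) (i : T + T) := if i is inl _ then true else false.

(** If [i] and [j] lay in different halves, even parity would put exactly one of [k], [l] in the
    left half, and the zero syndrome would make it equal to [i] or [j]. *)
Lemma S_sigma_kernel_quad (i j k l : Fr r + Fr r) :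
  (forall z, z \in S -> z + (e i + e j + (e k + e l)) \in S) ->
  i != k -> i != l -> j != k -> j != l -> isl i = isl j.
Proof.
move=> /S_sigma_kernel; rewrite !lftD !lft_e.
case: i j k l => i [] j [] k [] l //=; rewrite !(parD, synD, par0, syn0, par_e, syn_e);
  rewrite ?(addFF, add0r, addr0) => -[].
all: try by move=> /eqP.
all: move=> _ /add_eq0_Fr ->; rewrite ?eqxx //.
Qed.

Lemma S_sigma_non_Mollard : non_Mollard S.
Proof.
move=> t n C D phi ht hn _ _ [x [g [bg hM]]].
have gi := bij_inj bg; case: (bg) => gV gK gVK.
have key i j u v : i != j -> u != v -> isl (g (i, u)) = isl (g (j, u)) /\
    isl (g (i, u)) = isl (g (i, v)).
  move=> hij huv.
  (* Rectangle invariance is carried back along the isomorphism; the translation [x] cancels. *)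
  have rect z : z \in S -> z + (e (g (i, u)) + e (g (j, u)) + (e (g (i, v)) + e (g (j, v)))) \in S.
    move=> hz.
    have : x + [ffun k => z (g k)] \in Mollard C D phi by rewrite hM; apply/imsetP; exists z.
    move=> /(Mollard_rectangle i j u v); rewrite {1}hM => /imsetP[z' hz' h].
    suff -> : z + (e (g (i, u)) + e (g (j, u)) + (e (g (i, v)) + e (g (j, v)))) = z' by [].
    move: h; rewrite -addrA => /addrI/ffunP h; apply/ffunP=> k.
    by have := h (gV k); rewrite !ffunE gVK => <-; rewrite !(can2_eq gVK gK).
  have ne a b c d : (a, c) != (b, d) :> 'I_t * 'I_n -> g (a, c) != g (b, d).
    by apply: contra => /eqP/gi->.
  split.
    by apply: (S_sigma_kernel_quad rect); apply: ne; rewrite xpair_eqE (negbTE huv) ?andbF.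
  (* The same four corners, now paired along the other side of the rectangle. *)
  apply: (@S_sigma_kernel_quad _ _ (g (j, u)) (g (j, v))) => [z||||].
    by rewrite addrACA; apply: rect.
  1-4: by apply: ne; rewrite xpair_eqE (negbTE hij).
(* A second row and a second column are needed to complete any pair of grid points in one line to a
   rectangle. *)
have other q (hq : (2 <= q)%N) (i : 'I_q) : exists j : 'I_q, i != j.
  have /card_gt0P[j] : (0 < #|predC1 i|)%N by rewrite cardC1 card_ord -ltnS prednK // ltnW.
  by rewrite !inE eq_sym => hj; exists j.
have const i j u v : isl (g (i, u)) = isl (g (j, v)).
  have [u' hu] := other n hn u; have [j' hj] := other t ht j.
  have -> : isl (g (i, u)) = isl (g (j, u)).
    by have [->//|hij] := eqVneq i j; have [] := key i j u u' hij hu.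
  by have [->//|huv] := eqVneq u v; have [] := key j j' u v hj huv.
(* The grid points of [inl 0] and [inr 0] contradict the constancy of the half. *)
case El: (gV (inl 0)) => [i u]; case Er: (gV (inr 0)) => [j v].
by have := const i j u v; rewrite -El -Er !gVK.
Qed.

End Code.

Theorem theorem7 :
  forall r : nat, (3 <= r)%N -> r != 5%N ->
  exists s : {perm Fr r}, s 0%R = 0%R /\
    ext_perfect (S_sigma s) /\ neighbor_transitive (S_sigma s) /\
    non_Mollard (S_sigma s).
Proof.
move=> r hr hr5; have [f [m fm]] := structured_involution_exists hr hr5.
pose s := perm (inv_inj (si_invol fm)).
have sE : s =1 f by move=> x; rewrite permE.
have sm : structured_involution s m.
  have [h1 h2 h3 h4 h5 h6 h7] := fm; split=> // [x||a h|a b]; rewrite ?sE ?h1 ?h4 //.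
  by apply: h3 => x; rewrite -!sE h.
have s0 := si_0 sm.
exists s; split=> //; split; first exact: S_sigma_ext_perfect.
by split; [apply: S_sigma_neighbor_transitive sm | apply: S_sigma_non_Mollard sm].
Qed.
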